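(* Let $(\mathcal X,d)$ be a metric space (of datasets), let $g:\mathcal X\to\mathbb{Z}_{\ge0}$ be a count statistic, and let $\mu_2>\mu_1>0$. Put $f_\infty=T(P(\mu_1),P(\mu_2))$. Let $$N_1=\frac{\log(\mu_2/\mu_1)}{w_g(1)},\qquad h:\mathbb{R}\to\mathbb{R},\quad h(y)=e^{N_1y}=\left(\frac{\mu_2}{\mu_1}\right)^{y/w_g(1)},\qquad N_2=\frac{|\mu_2-\mu_1|}{w_{h\circ g}(1)},$$ where it is assumed that $0<w_g(1)<\infty$ and $0<w_{h\circ g}(1)<\infty$. Consider the mechanism (Markov kernel) $M$ from $\mathbb{Z}_{\ge0}$ to $\mathbb{Z}_{\ge0}$ which, on input $g(x)$, outputs a sample $M(g(x))\sim P\left(N_2e^{N_1g(x)}\right)$. Then, pointwise on $[0,1]$, $$\inf_{x_1,x_2\in\mathcal X:\ d(x_1,x_2)\le1,\ g(x_2)\ge g(x_1)}T\big(M(g(x_1)),M(g(x_2))\big)\ \ge\ T(P(\mu_1),P(\mu_2))=f_\infty,$$ $$\inf_{x_1,x_2\in\mathcal X:\ d(x_1,x_2)\le1,\ g(x_2)\le g(x_1)}T\big(M(g(x_1)),M(g(x_2))\big)\ \ge\ T(P(\mu_2),P(\mu_1))=f_\infty^{-1}.$$ Consequently, with $f_{\mu_1,\mu_2}:=\min(f_\infty,f_\infty^{-1})$, $$\inf_{x_1,x_2\in\mathcal X:\ d(x_1,x_2)\le1}T\big(M(g(x_1)),M(g(x_2))\big)\ \ge\ f_{\mu_1,\mu_2}\quad\text{pointwise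 on }[0,1].$$
   Context: $P(\lambda)$ denotes the Poisson distribution with mean $\lambda>0$ on $\mathbb{Z}_{\ge0}$. For probability measures $P,Q$ on a measurable space $(\mathcal W,\mathcal F)$, the trade-off function $T(P,Q):[0,1]\to[0,1]$ is $$T(P,Q)(\alpha)=\inf\{\mathbb{E}_Q[1-\varphi] : \varphi:(\mathcal W,\mathcal F)\to[0,1]\text{ measurable},\ \mathbb{E}_P[\varphi]\le\alpha\}.$$ For random elements $A,B$ of the same measurable space, $T(A,B)$ means the trade-off function of their laws. The generalized inverse of a trade-off function $f$ is $f^{-1}(\alpha)=\inf\{t\in[0,1]:f(t)\le\alpha\}$; if $f=T(P,Q)$ then $f^{-1}=T(Q,P)$. For a real-valued function $u$ on $(\mathcal X,d)$, $w_u(1):=\sup_{d(x,y)\le1}|u(x)-u(y)|$. The minimum of functions is taken pointwise. *)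

(* Defs.v *)
From HB Require Import structures.
From mathcomp Require Import all_boot all_order all_algebra.
From mathcomp Require Import all_classical all_reals all_analysis.

Set Implicit Arguments.
Unset Strict Implicit.
Unset Printing Implicit Defensive.

Import Order.TTheory GRing.Theory Num.Theory.

Local Open Scope classical_set_scope.
Local Open Scope ring_scope.
Local Open Scope ereal_scope.

(* [poisson_prob] carries an unused natural-number argument, set here to 0, and
   is the Poisson law only for [0 < lambda] (it is [\d_0] otherwise). *)
Definition Poisson (R : realType) (lambda : R) : probability nat R :=
  poisson_prob lambda 0.

(* The infimum is taken in [\bar R]; for [0 <= alpha] the set is nonempty
   ([phi = 0]) and the value lies in [0, 1]. *)
Definition trade_off d (W : measurableType d) (R : realType)
    (P Q : probability W R) (alpha : R) : \bar R :=
  ereal_inf [set 'E_Q[(fun w => 1 - phi w)%R] | phi in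
    [set phi : {mfun W >-> R} |
      (forall w, 0 <= phi w <= 1)%R /\ 'E_P[phi] <= alpha%:E]].

Definition generalized_inverse (R : realType) (f : R -> \bar R) (alpha : R)
    : \bar R :=
  ereal_inf [set t%:E | t in [set t : R | (0 <= t <= 1)%R /\ f t <= alpha%:E]].

Definition modulus (R : realType) (X : metricType R) (u : X -> R) (r : R)
    : \bar R :=
  ereal_sup [set `|u p.1 - u p.2|%:E | p in
    [set p : X * X | (mdist p.1 p.2 <= r)%R]].

(* [M x] with the probability structure that the bare measure [M x] lacks. *)
Definition kernel_law d d' (X : measurableType d) (Y : measurableType d')
    (R : realType) (M : R.-pker X ~> Y) (x : X) : set Y -> \bar R := M x.

HB.instance Definition _ d d' (X : measurableType d) (Y : measurableType d')
    (R : realType) (M : R.-pker X ~> Y) (x : X) :=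
  Measure.on (kernel_law M x).

HB.instance Definition _ d d' (X : measurableType d) (Y : measurableType d')
    (R : realType) (M : R.-pker X ~> Y) (x : X) :=
  Measure_isProbability.Build _ _ _ (kernel_law M x) (prob_kernel x).

(* Main.v *)
(* If X is Poisson of mean mu, then thinning X with retention probability p and
   adding an independent Poisson variable of mean c gives a Poisson variable of
   mean p mu + c.  This randomized map does not depend on mu, so it turns a test
   of P(p mu_1 + c) against P(p mu_2 + c) into a test of P(mu_1) against P(mu_2)
   with the same errors, and the trade-off function of the first pair dominates
   that of the second.  For 0 < a_1 <= a_2, the pair (a_1, a_2) is the image of
   (mu_1, mu_2) under such an affine map with 0 <= p <= 1 and c >= 0 exactly when
   a_2 - a_1 <= mu_2 - mu_1 and a_2 / a_1 <= mu_2 / mu_1; the two calibrations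
   N_2 and N_1 provide these two bounds. *)
Require Import Defs.
From HB Require Import structures.
From mathcomp Require Import all_boot all_order all_algebra.
From mathcomp Require Import all_classical all_reals all_analysis.
From mathcomp Require Import measurable_realfun ring lra.

Set Implicit Arguments.
Unset Strict Implicit.
Unset Printing Implicit Defensive.

Import Order.TTheory GRing.Theory Num.Theory.

Local Open Scope classical_set_scope.
Local Open Scope ring_scope.

(** * Series over Poisson weights: total mass, superposition, thinning *)

(** Both sides sum [a] over all pairs: [(n, j)] with [j <= n] corresponds bijectively to
    [(j, n - j)], and nonnegativity makes the order of summation immaterial. *)
Lemma nneseries_antidiagonal (R : realType) (a : nat -> nat -> \bar R) :
  (forall j k, 0 <= a j k)%E ->
  (\sum_(j <oo) \sum_(k <oo) a j k =
   \sum_(n <oo) \sum_(j < n.+1) a j (n - j)%N)%E.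
Proof.
move=> a0.
rewrite [LHS]nneseries_esumT; last by move=> j; exact: nneseries_ge0.
under eq_esum do rewrite nneseries_esumT//.
rewrite esum_esum// (reindex_esum ([set: nat] `*`` (fun n => `I_n.+1)) _
  (fun p => (p.2, (p.1 - p.2)%N))); last first.
  split => [[n j]//|[n j] [n' j']|[j k] _] /=.
    rewrite !inE => -[_ jn] [_ jn'] [jj e]; subst j'.
    by rewrite -(subnK (jn : (j <= n)%N)) e subnK.
  by exists ((j + k)%N, j); rewrite /= ?addKn// ltnS leq_addr.
rewrite -(esum_esum (a := fun n j => a j (n - j)%N))//.
rewrite nneseries_esumT; last by move=> n; apply: sume_ge0.
by apply: eq_esum => n _; rewrite esum_fset//= -fsbig_ord.
Qed.

(* Unlike [poisson_pmf], whose value at rate 0 is 1, this is the Dirac mass at 0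
   when [a = 0]. *)
Definition poisson_weight (R : realType) (a : R) (k : nat) : R :=
  expR (- a) * (a ^+ k / k`!%:R).

Lemma poisson_weight_ge0 (R : realType) (a : R) k :
  0 <= a -> 0 <= poisson_weight a k.
Proof. by move=> a0; rewrite mulr_ge0 ?expR_ge0// divr_ge0 ?exprn_ge0. Qed.

(** The binomial theorem, read as the convolution of two Poisson laws. *)
Lemma poisson_weightD (R : realType) (a b : R) n :
  \sum_(j < n.+1) poisson_weight a j * poisson_weight b (n - j) =
  poisson_weight (a + b) n.
Proof.
rewrite /poisson_weight opprD expRD addrC exprDn mulr_suml mulr_sumr.
apply: eq_bigr => j _; have jn : (j <= n)%N by rewrite -ltnS.
have fj i : i`!%:R != 0 :> R by rewrite pnatr_eq0 -lt0n fact_gt0.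
rewrite -[_ *+ 'C(_, _)]mulr_natr
  (_ : 'C(n, j)%:R = n`!%:R / (j`!%:R * (n - j)`!%:R) :> R).
  by field; rewrite !fj.
by rewrite -(bin_fact jn) !natrM; field; rewrite !fj.
Qed.

(** Working with the series rather than with [Poisson] treats rate 0, reached when [p = 0] or
    [c = 0], uniformly with positive rates. *)
Definition poisson_mean (R : realType) (a : R) (phi : nat -> R) : \bar R :=
  (\sum_(k <oo) (poisson_weight a k * phi k)%:E)%E.

Lemma poisson_mean1 (R : realType) (a : R) :
  0 <= a -> poisson_mean a (fun=> 1) = 1%E.
Proof.
move=> a0; rewrite /poisson_mean.
under eq_eseriesr do rewrite mulr1 EFinM.
rewrite nneseriesZl; last by move=> k _; rewrite lee_fin divr_ge0 ?exprn_ge0.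
rewrite (_ : limn _ = (expR a)%:E); first by rewrite -EFinM -expRD addNr expR0.
rewrite /expR -EFin_lim; last exact: is_cvg_series_exp_coeff.
by apply/congr_lim/funext => n /=; rewrite /series/= -sumEFin.
Qed.

Lemma le_poisson_mean (R : realType) (a : R) (phi psi : nat -> R) :
  0 <= a -> (forall k, 0 <= phi k <= psi k) ->
  (poisson_mean a phi <= poisson_mean a psi)%E.
Proof.
move=> a0 h; apply: lee_nneseries => k _; have /andP[phi0 phipsi] := h k.
  by rewrite lee_fin mulr_ge0// poisson_weight_ge0.
by rewrite lee_fin ler_wpM2l// poisson_weight_ge0.
Qed.

Lemma poisson_mean_ge0 (R : realType) (a : R) (phi : nat -> R) :
  0 <= a -> (forall k, 0 <= phi k) -> (0 <= poisson_mean a phi)%E.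
Proof.
move=> a0 phi0; apply: nneseries_ge0 => k _ _.
by rewrite lee_fin mulr_ge0// poisson_weight_ge0.
Qed.

Lemma poisson_mean_le1 (R : realType) (a : R) (phi : nat -> R) :
  0 <= a -> (forall k, 0 <= phi k <= 1) -> (poisson_mean a phi <= 1)%E.
Proof. by move=> a0 phi01; rewrite -(poisson_mean1 a0) le_poisson_mean. Qed.

Lemma poisson_mean_fin_num (R : realType) (a : R) (phi : nat -> R) :
  0 <= a -> (forall k, 0 <= phi k <= 1) -> poisson_mean a phi \is a fin_num.
Proof.
move=> a0 phi01; rewrite ge0_fin_numE.
  by rewrite (le_lt_trans (poisson_mean_le1 a0 phi01))// ltry.
by apply: poisson_mean_ge0 => // k; case/andP: (phi01 k).
Qed.

(** Adds an independent Poisson variable of mean [c]: the double series is resummed over the value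
    [n] of [j + k]. *)
Lemma poisson_mean_shift (R : realType) (a c : R) (phi : nat -> R) :
  0 <= a -> 0 <= c -> (forall k, 0 <= phi k <= 1) ->
  poisson_mean a (fun j => fine (poisson_mean c (fun k => phi (j + k)%N))) =
  poisson_mean (a + c) phi.
Proof.
move=> a0 c0 phi01; have phi0 k : 0 <= phi k by case/andP: (phi01 k).
rewrite {1}/poisson_mean.
under eq_eseriesr => j _.
  rewrite EFinM fineK; last by apply: poisson_mean_fin_num.
  rewrite /poisson_mean -nneseriesZl; last first.
    by move=> k _; rewrite lee_fin mulr_ge0// poisson_weight_ge0.
  over.
rewrite nneseries_antidiagonal; last first.
  move=> j k; rewrite -EFinM lee_fin mulr_ge0 ?poisson_weight_ge0//.
  by rewrite mulr_ge0 ?poisson_weight_ge0.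
apply: eq_eseriesr => n _; rewrite -poisson_weightD mulr_suml -sumEFin.
apply: eq_bigr => j _; rewrite subnKC; last by rewrite -ltnS.
by rewrite -EFinM mulrA.
Qed.

(** A Poisson number of points splits into [j] retained and [k] discarded ones, independent Poisson
    variables of means [p * a] and [q * a]; the discarded ones sum out to 1. *)
Lemma poisson_mean_thinning (R : realType) (a p q : R) (phi : nat -> R) :
  0 <= a -> 0 <= p -> 0 <= q -> p + q = 1 -> (forall k, 0 <= phi k) ->
  poisson_mean a
    (fun n => \sum_(j < n.+1) p ^+ j * q ^+ (n - j) *+ 'C(n, j) * phi j) =
  poisson_mean (p * a) phi.
Proof.
move=> a0 p0 q0 pq phi0.
have pa0 : 0 <= p * a by rewrite mulr_ge0.
have qa0 : 0 <= q * a by rewrite mulr_ge0.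
transitivity (\sum_(j <oo) \sum_(k <oo)
  ((poisson_weight (p * a) j * phi j)%:E * (poisson_weight (q * a) k)%:E))%E.
  rewrite nneseries_antidiagonal; last first.
    move=> j k; rewrite -EFinM lee_fin mulr_ge0 ?poisson_weight_ge0//.
    by rewrite mulr_ge0 ?poisson_weight_ge0.
  apply: eq_eseriesr => n _; rewrite mulr_sumr -sumEFin.
  apply: eq_bigr => j _; rewrite -EFinM; congr EFin.
  have jn : (j <= n)%N by rewrite -ltnS.
  have fj i : i`!%:R != 0 :> R by rewrite pnatr_eq0 -lt0n fact_gt0.
  have ea : expR (- a) = expR (- (p * a)) * expR (- (q * a)).
    by rewrite -expRD; congr expR; rewrite -opprD -mulrDl pq mul1r.
  have an : a ^+ n = a ^+ j * a ^+ (n - j) by rewrite -exprD subnKC.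
  rewrite /poisson_weight ea !exprMn an -(bin_fact jn) !natrM.
  rewrite -[_ *+ 'C(_, _)]mulr_natr; field.
  by rewrite !fj pnatr_eq0 -lt0n bin_gt0.
apply: eq_eseriesr => j _; rewrite nneseriesZl; last first.
  by move=> k _; rewrite lee_fin poisson_weight_ge0.
rewrite (_ : limn _ = poisson_mean (q * a) (fun=> 1)); last first.
  by apply: eq_eseriesr => k _; rewrite mulr1.
by rewrite poisson_mean1// mule1.
Qed.

Lemma Poisson_expectation (R : realType) (a : R) (phi : {mfun nat >-> R}) :
  0 < a -> (forall k, 0 <= phi k) ->
  ('E_(Poisson a)[phi])%E = poisson_mean a phi.
Proof.
move=> a0 phi0; rewrite unlock.
have -> : [set: nat] = \bigcup_k [set k].
  by apply/seteqP; split => // k _; exists k.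
rewrite ge0_integral_bigcup//; last 2 first.
  by move=> k _; rewrite lee_fin.
  by move=> i j _ _ [k [-> ->]].
apply: eq_eseriesr => k _.
transitivity (\int[Poisson a]_(x in [set k]) cst (phi k)%:E x)%E.
  by apply: eq_integral => x; rewrite inE /= => ->.
rewrite integral_cst// /Poisson/= /poisson_prob a0 esum_set1.
  by rewrite -EFinM /poisson_pmf a0 /poisson_weight; congr EFin; ring.
by rewrite lee_fin poisson_pmf_ge0.
Qed.

(** * Tests, their errors, and trade-off functions *)

Section tests.
Context d (W : measurableType d) (R : realType).
Implicit Types (P Q : probability W R) (phi : {mfun W >-> R}).

Definition is_test (phi : W -> R) := forall w, 0 <= phi w <= 1.

Lemma test_integrable P phi : is_test phi -> P.-integrable setT (EFin \o phi).
Proof.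
move=> phi01; apply: measurable_bounded_integrable => //.
  by rewrite /= probability_setT ltry.
exists 1; split; first exact: num_real.
move=> M M1 w _ /=; case/andP: (phi01 w) => ? ?.
by rewrite ger0_norm// (le_trans _ (ltW M1)).
Qed.

Lemma test_expectationE P phi : is_test phi ->
  ('E_P[phi])%E = (fine 'E_P[phi])%:E.
Proof.
move=> phi01; rewrite fineK// unlock.
exact: integrable_fin_num (test_integrable P phi01).
Qed.

Lemma test_expectation_affine P phi (a b : R) : is_test phi ->
  ('E_P[(fun w => a + b * phi w)%R])%E = (a + b * fine 'E_P[phi])%:E.
Proof.
move=> phi01; rewrite EFinD EFinM -test_expectationE// unlock.
have iphi := test_integrable P phi01.
have -> : (fun w => (a + b * phi w)%:E) =
    (fun w => (cst a w)%:E + (b%:E * (phi w)%:E))%E.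
  by apply/funext => w; rewrite -EFinM -EFinD.
rewrite integralD//=.
- by rewrite integral_cst//= probability_setT mule1 integralZl.
- exact: finite_measure_integrable_cst.
- exact: integrableZl.
Qed.

Lemma test_expectation_onem P phi : is_test phi ->
  ('E_P[(fun w => 1 - phi w)%R])%E = (1 - fine 'E_P[phi])%:E.
Proof.
move=> phi01; rewrite -[in RHS]mulN1r -test_expectation_affine//.
by congr expectation; apply/funext => w; rewrite mulN1r.
Qed.

Lemma test_expectation_ge0 P phi : is_test phi -> 0 <= fine 'E_P[phi]%E.
Proof.
by move=> phi01; apply/fine_ge0/expectation_ge0 => w; case/andP: (phi01 w).
Qed.

Lemma test_expectation_le1 P phi : is_test phi -> fine 'E_P[phi]%E <= 1.
Proof.
move=> phi01; rewrite -subr_ge0 -lee_fin -test_expectation_onem//.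
by apply: expectation_ge0 => w; rewrite subr_ge0; case/andP: (phi01 w).
Qed.

Lemma affine_mfun phi (a b : R) :
  exists psi : {mfun W >-> R}, psi = (fun w => a + b * phi w) :> (W -> R).
Proof.
have m : (fun w => a + b * phi w) \in @mfun _ _ W R.
  rewrite inE; apply: measurable_funD => //; exact: measurable_funM.
by exists (mfun_Sub m).
Qed.

(** Turns the infimum into a bound over tests with real errors; applied to [lexx], it bounds the
    trade-off function above by the error of any chosen test. *)
Lemma trade_off_geP P Q (alpha : R) (y : \bar R) :
  (forall phi, is_test phi -> fine 'E_P[phi]%E <= alpha ->
    (y <= (1 - fine 'E_Q[phi])%:E)%E) <-> (y <= trade_off P Q alpha)%E.
Proof.
split=> [h|h phi phi01 Pphi].
  apply: le_ereal_inf_tmp => _ [phi [phi01 Pphi] <-].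
  by rewrite test_expectation_onem//; apply: h;
    rewrite // -lee_fin -test_expectationE.
apply: (le_trans h); apply: ereal_inf_lbound; exists phi.
  by split => //; rewrite test_expectationE// lee_fin.
exact: test_expectation_onem.
Qed.

End tests.

(** Every pair of errors achieved on the right is achieved on the left, so the right-hand infimum
    runs over fewer values. *)
Lemma trade_off_post_processing d d' (W : measurableType d)
    (W' : measurableType d') (R : realType) (P Q : probability W R)
    (P' Q' : probability W' R) (alpha : R) :
  (forall phi : {mfun W' >-> R}, is_test phi ->
    exists2 psi : {mfun W >-> R}, is_test psi &
      'E_P[psi] = 'E_P'[phi] /\ 'E_Q[psi] = 'E_Q'[phi])%E ->
  (trade_off P Q alpha <= trade_off P' Q' alpha)%E.
Proof.
move=> PQ; apply/trade_off_geP => phi phi01 Pphi.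
have [psi psi01 [P_psi <-]] := PQ _ phi01.
by move/trade_off_geP : (lexx (trade_off P Q alpha)); apply; rewrite // P_psi.
Qed.

(* Swapping a test [phi] with [1 - phi] gives the inequality [>=].  Conversely
   a test with type II error at most [alpha + e] is scaled down to one with
   error at most [alpha]; domination of [P] by [Q] bounds the cost of scaling
   by [C * e], also when [alpha = 0]. *)
Lemma generalized_inverse_trade_off d (W : measurableType d) (R : realType)
    (P Q : probability W R) (C alpha : R) :
  (forall phi : {mfun W >-> R}, is_test phi ->
    'E_P[phi] <= C%:E * 'E_Q[phi])%E ->
  0 <= alpha ->
  generalized_inverse (trade_off P Q) alpha = trade_off Q P alpha.
Proof.
move=> PCQ alpha0; apply/eqP; rewrite eq_le; apply/andP; split.
  apply/trade_off_geP => phi phi01 Qphi; apply: ereal_inf_lbound.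
  exists (1 - fine 'E_P[phi]) => //; split.
    by rewrite subr_ge0 test_expectation_le1// gerBl test_expectation_ge0.
  have [psi psiE] := affine_mfun phi 1 (-1).
  have psi01 : is_test psi.
    by move=> w; rewrite psiE; have := phi01 w; lra.
  have Epsi (P0 : probability W R) : fine 'E_P0[psi] = 1 - fine 'E_P0[phi].
    by rewrite psiE test_expectation_affine//= mulN1r.
  have /trade_off_geP := lexx (trade_off P Q (1 - fine 'E_P[phi])).
  move=> /(_ psi psi01); rewrite !Epsi => /(_ (lexx _))/le_trans; apply.
  by rewrite lee_fin subKr.
apply: le_ereal_inf_tmp => _ [t [/andP[t0 t1] ft] <-].
apply/lee_addgt0Pr => e e0.
have C0 : 0 <= C.
  have one01 : is_test (cst 1 : {mfun W >-> R}) by move=> w /=; lra.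
  have := PCQ _ one01; rewrite !expectation_cst -EFinM lee_fin mulr1.
  exact: le_trans.
(* Chosen so that [C * e' <= e]; the [+ 1] keeps the denominator positive. *)
pose e' := e / (C + 1).
have e'0 : 0 < e' by rewrite divr_gt0// ltr_wpDl.
have /ereal_inf_lt[_ [psi [psi01 Ppsi] <-] Qpsi] :
    (trade_off P Q t < (alpha + e')%:E)%E.
  by rewrite (le_lt_trans ft)// lte_fin ltrDl.
rewrite test_expectation_onem// lte_fin in Qpsi.
rewrite test_expectationE// lee_fin in Ppsi.
(* Scaling [1 - psi] by [s] brings its mean under [Q] from below [alpha + e'] to at most [alpha]. *)
pose s := alpha / (alpha + e').
have ae0 : 0 < alpha + e' by rewrite ltr_wpDl.
have s0 : 0 <= s by rewrite divr_ge0// ltW.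
have s1 : s <= 1 by rewrite ler_pdivrMr// mul1r lerDl ltW.
have [phi phiE] := affine_mfun psi s (- s).
have phi01 : is_test phi.
  move=> w; rewrite phiE; have /andP[? ?] := psi01 w.
  have -> : s + - s * psi w = s * (1 - psi w) by ring.
  by rewrite mulr_ge0 ?subr_ge0//= mulr_ile1 ?subr_ge0// gerBl.
have Ephi (P0 : probability W R) : fine 'E_P0[phi] = s * (1 - fine 'E_P0[psi]).
  by rewrite phiE test_expectation_affine//=; ring.
have [chi chiE] := affine_mfun psi 1 (-1).
have chi01 : is_test chi by move=> w; rewrite chiE; have := psi01 w; lra.
have := PCQ _ chi01.
rewrite (test_expectationE P)// (test_expectationE Q)// -EFinM lee_fin.
rewrite chiE !test_expectation_affine//= => dom.
have /trade_off_geP/(_ phi phi01) := lexx (trade_off Q P alpha).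
rewrite !Ephi => /(_ _)/le_trans; apply.
  rewrite -[leRHS](divfK (lt0r_neq0 ae0)) -/s.
  by rewrite ler_wpM2l// ltW.
rewrite -EFinD lee_fin.
set x := fine _ in Ppsi dom *; set y := fine _ in Qpsi dom.
(* The cost of scaling: [1 - s] is [e' / (alpha + e')] and domination gives
   [1 - x <= C * (alpha + e')], so [alpha + e'] cancels and [C * e'] remains. *)
have h : (1 - s) * (1 - x) <= e.
  have -> : 1 - s = e' / (alpha + e') by rewrite /s; field; rewrite gt_eqF.
  rewrite mulrAC ler_pdivrMr//.
  rewrite (@le_trans _ _ (e' * (C * (alpha + e'))))//.
    by rewrite ler_pM2l//; nra.
  rewrite mulrA ler_pM2r// /e' mulrAC ler_pdivrMr ?ltr_wpDl//.
  by rewrite ler_pM2l// lerDl.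
nra.
Qed.

(** * Poisson families: domination and affine changes of the mean *)

(** Termwise: [expR (b - a)] exchanges the normalizations, and [a ^+ k <= b ^+ k]. This supplies the
    domination used to invert the Poisson trade-off function. *)
Lemma poisson_mean_dominated (R : realType) (a b : R) (phi : nat -> R) :
  0 <= a <= b -> (forall k, 0 <= phi k) ->
  (poisson_mean a phi <= (expR (b - a))%:E * poisson_mean b phi)%E.
Proof.
move=> /andP[a0 ab] phi0; have b0 := le_trans a0 ab.
rewrite /poisson_mean -nneseriesZl; last first.
  by move=> k _; rewrite lee_fin mulr_ge0 ?poisson_weight_ge0.
apply: lee_nneseries => k _; rewrite lee_fin.
  by rewrite mulr_ge0 ?poisson_weight_ge0.
rewrite /poisson_weight !mulrA -expRD (_ : b - a - b = - a); last by ring.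
by rewrite !ler_wpM2r// ler_wpM2l ?expR_ge0// lerXn2r.
Qed.

(* [psi n] is the mean of [phi] at a Binomial(n, p) variable plus an independent
   Poisson variable of mean [c]. *)
Lemma Poisson_post_processing (R : realType) (p c : R) (phi : nat -> R) :
  0 <= p <= 1 -> 0 <= c -> is_test phi ->
  exists2 psi : {mfun nat >-> R}, is_test psi &
    forall a, 0 <= a -> poisson_mean a psi = poisson_mean (p * a + c) phi.
Proof.
move=> /andP[p0 p1] c0 phi01.
pose chi j := fine (poisson_mean c (fun k => phi (j + k)%N)).
have chi01 : is_test chi.
  move=> j; have phij : is_test (fun k => phi (j + k)%N) by [].
  rewrite fine_ge0 ?poisson_mean_ge0//=; last first.
    by move=> k; case/andP: (phi01 (j + k)%N).
  by rewrite -lee_fin fineK ?poisson_mean_fin_num// poisson_mean_le1.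
have chi0 j : 0 <= chi j by case/andP: (chi01 j).
pose psi n := \sum_(j < n.+1) p ^+ j * (1 - p) ^+ (n - j) *+ 'C(n, j) * chi j.
have w0 n j : 0 <= p ^+ j * (1 - p) ^+ (n - j) *+ 'C(n, j).
  by rewrite mulrn_wge0// mulr_ge0// exprn_ge0// subr_ge0.
have psi01 : is_test psi.
  move=> n; rewrite sumr_ge0 => [/=|j _]; last by rewrite mulr_ge0.
  (* As [chi] is at most 1, the sum is at most the total mass of the binomial law. *)
  rewrite (@le_trans _ _ (((1 - p) + p) ^+ n))//; last by rewrite subrK expr1n.
  rewrite exprDn; apply: ler_sum => j _.
  rewrite [_ ^+ _ * p ^+ j]mulrC ler_piMr//.
  by case/andP: (chi01 j).
have m : psi \in @mfun _ _ nat R by rewrite inE.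
exists (mfun_Sub m) => // a a0.
rewrite -poisson_mean_shift ?mulr_ge0// -(@poisson_mean_thinning _ a p (1 - p))//.
  by rewrite subr_ge0.
by rewrite addrC subrK.
Qed.

(** The order of [mu1] and [mu2] is left free, so that one lemma serves both increasing and
    decreasing counts. *)
Lemma trade_off_Poisson_affine (R : realType) (mu1 mu2 p c alpha : R) :
  0 < mu1 -> 0 < mu2 -> 0 <= p <= 1 -> 0 <= c ->
  0 < p * mu1 + c -> 0 < p * mu2 + c ->
  (trade_off (Poisson mu1) (Poisson mu2) alpha <=
   trade_off (Poisson (p * mu1 + c)) (Poisson (p * mu2 + c)) alpha)%E.
Proof.
move=> mu10 mu20 p01 c0 a10 a20; apply: trade_off_post_processing => phi phi01.
have [psi psi01 psiE] := Poisson_post_processing p01 c0 phi01.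
exists psi => //; have ge0 (f : nat -> R) : is_test f -> forall k, 0 <= f k.
  by move=> f01 k; case/andP: (f01 k).
by split; rewrite !Poisson_expectation ?psiE ?ltW//; apply: ge0.
Qed.

(** * Calibration of the rates and conclusion *)

(** [p] and [c] are the slope and intercept of the line through [(mu1, a1)] and [(mu2, a2)]. The
    difference bound gives [p <= 1], the ratio bound [0 <= c]. *)
Lemma affine_coefficients (R : realFieldType) (mu1 mu2 a1 a2 : R) :
  0 < mu1 -> mu1 < mu2 -> 0 < a1 -> a1 <= a2 ->
  a2 - a1 <= mu2 - mu1 -> a2 / a1 <= mu2 / mu1 ->
  exists p c, [/\ 0 <= p <= 1, 0 <= c, a1 = p * mu1 + c & a2 = p * mu2 + c].
Proof.
move=> mu10 mu12 a10 a12 diff ratio.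
have d0 : 0 < mu2 - mu1 by rewrite subr_gt0.
exists ((a2 - a1) / (mu2 - mu1)), (a1 - (a2 - a1) / (mu2 - mu1) * mu1).
split.
- by rewrite divr_ge0 ?subr_ge0 ?(ltW mu12)//= ler_pdivrMr// mul1r.
- rewrite subr_ge0 mulrAC ler_pdivrMr//.
  move: ratio; rewrite ler_pdivrMr// mulrAC ler_pdivlMr// => ratio.
  by rewrite mulrBl mulrBr [a1 * mu2]mulrC lerD2r.
- by rewrite subrKC.
- by field; rewrite subr_eq0 gt_eqF.
Qed.

Lemma le_modulus (R : realType) (X : metricType R) (u : X -> R) (r : R) x y :
  (modulus u r < +oo)%E -> mdist x y <= r ->
  `|u x - u y| <= fine (modulus u r).
Proof.
move=> uoo xy.
have uxy : (`|u x - u y|%:E <= modulus u r)%E.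
  by apply: ereal_sup_ubound; exists (x, y).
rewrite -lee_fin fineK// ge0_fin_numE//.
exact: le_trans uxy.
Qed.

(** The kernel law and the Poisson law agree as set functions but carry different probability
    structures, hence the pointwise hypotheses. *)
Lemma trade_off_eq d (W : measurableType d) (R : realType)
    (P Q P' Q' : probability W R) (alpha : R) :
  P =1 P' -> Q =1 Q' -> trade_off P Q alpha = trade_off P' Q' alpha.
Proof.
move=> PP' QQ'.
have E (P0 P0' : probability W R) (f : W -> R) :
    P0 =1 P0' -> ('E_P0[f] = 'E_P0'[f])%E.
  by move=> PP0; rewrite unlock; apply: eq_measure_integral => A _ _; exact: PP0.
apply/eqP; rewrite eq_le; apply/andP; split;
  apply: trade_off_post_processing => phi phi01; exists phi => //;
  by split; exact: E.
Qed.

Theorem theorem13 (R : realType) (X : metricType R) (g : X -> nat)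
    (mu1 mu2 : R) (mu1_gt0 : 0 < mu1) (mu1_lt_mu2 : mu1 < mu2) :
  let f_inf := trade_off (Poisson mu1) (Poisson mu2) in
  let w_g := modulus (fun x => (g x)%:R) 1 in
  (0 < w_g < +oo)%E ->
  let N1 := ln (mu2 / mu1) / fine w_g in
  let h := fun y : R => expR (N1 * y) in
  let w_hg := modulus (fun x => h (g x)%:R) 1 in
  (0 < w_hg < +oo)%E ->
  let N2 : R := `|mu2 - mu1| / fine w_hg in
  forall M : R.-pker nat ~> nat,
  (forall (x : X) (U : set nat),
      M (g x) U = Poisson (N2 * expR (N1 * (g x)%:R)) U) ->
  let T_M := fun (alpha : R) (x : X * X) =>
    trade_off (kernel_law M (g x.1)) (kernel_law M (g x.2)) alpha in
  forall alpha : R, 0 <= alpha <= 1 ->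
  [/\ (f_inf alpha <=
        ereal_inf [set T_M alpha x | x in
          [set x : X * X | (mdist x.1 x.2 <= 1)%R /\ (g x.1 <= g x.2)%N]])%E,
      (trade_off (Poisson mu2) (Poisson mu1) alpha <=
        ereal_inf [set T_M alpha x | x in
          [set x : X * X | (mdist x.1 x.2 <= 1)%R /\ (g x.2 <= g x.1)%N]])%E,
      trade_off (Poisson mu2) (Poisson mu1) alpha =
        generalized_inverse f_inf alpha &
      (Order.min (f_inf alpha) (generalized_inverse f_inf alpha) <=
        ereal_inf [set T_M alpha x | x in
          [set x : X * X | (mdist x.1 x.2 <= 1)%R]])%E].
Proof.
move=> f_inf w_g w_g_fin N1 h w_hg w_hg_fin N2 M ME T_M alpha /andP[alpha0 _].
have mu20 := lt_trans mu1_gt0 mu1_lt_mu2.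
case/andP: w_g_fin => wg0 wgoo; case/andP: w_hg_fin => whg0 whgoo.
have fwg0 : 0 < fine w_g by rewrite fine_gt0// wg0.
have fwhg0 : 0 < fine w_hg by rewrite fine_gt0// whg0.
have N20 : 0 < N2 by rewrite divr_gt0// normr_gt0 subr_eq0 gt_eqF.
have N10 : 0 < N1 by rewrite divr_gt0// ln_gt0// ltr_pdivlMr// mul1r.
pose rate x := N2 * expR (N1 * (g x)%:R).
have rate0 x : 0 < rate x by rewrite mulr_gt0// expR_gt0.
have rateP x y : mdist x y <= 1 -> (g x <= g y)%N -> exists p c,
    [/\ 0 <= p <= 1, 0 <= c, rate x = p * mu1 + c & rate y = p * mu2 + c].
  move=> xy gxy; apply: affine_coefficients => //.
  - by rewrite ler_pM2l// ler_expR ler_pM2l// ler_nat.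
  (* The difference of rates is at most [N2] times [w_hg], which is [mu2 - mu1]. *)
  - rewrite -mulrBr (le_trans (ler_norm _))// normrM gtr0_norm// distrC.
    rewrite (le_trans (ler_wpM2l (ltW N20) (le_modulus whgoo xy)))//.
    by rewrite divfK ?gt_eqF// gtr0_norm// subr_gt0.
  (* [N2] cancels in the ratio, whose logarithm is [N1] times a count difference of at most [w_g],
     hence at most [ln (mu2 / mu1)]. *)
  - rewrite /rate -mulf_div divff ?gt_eqF// mul1r -expRB -mulrBr.
    rewrite -[leRHS]lnK; last by rewrite posrE divr_gt0.
    rewrite ler_expR mulrAC ler_pdivrMr// ler_wpM2l//.
      by rewrite ln_ge0// ler_pdivlMr// mul1r ltW.
    rewrite (le_trans (ler_norm _))// distrC; exact: (le_modulus wgoo).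
have TM x : T_M alpha x =
    trade_off (Poisson (rate x.1)) (Poisson (rate x.2)) alpha.
  by apply: trade_off_eq => U; exact: ME.
have up x : mdist x.1 x.2 <= 1 -> (g x.1 <= g x.2)%N ->
    (f_inf alpha <= T_M alpha x)%E.
  move=> xy gxy; rewrite TM; have [p [c [p01 c0 ex ey]]] := rateP _ _ xy gxy.
  by rewrite ex ey trade_off_Poisson_affine// -?ex -?ey.
have down x : mdist x.1 x.2 <= 1 -> (g x.2 <= g x.1)%N ->
    (trade_off (Poisson mu2) (Poisson mu1) alpha <= T_M alpha x)%E.
  (* Symmetry of the distance puts the smaller count first, so [mu1] is matched with [x.2]. *)
  rewrite metric_sym => xy gxy; rewrite TM.
  have [p [c [p01 c0 ex ey]]] := rateP _ _ xy gxy.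
  by rewrite ex ey trade_off_Poisson_affine// -?ex -?ey.
have inv : trade_off (Poisson mu2) (Poisson mu1) alpha =
    generalized_inverse f_inf alpha.
  apply/esym/(@generalized_inverse_trade_off _ _ _ _ _ (expR (mu2 - mu1))) => //.
  move=> phi phi01; have phi0 k : 0 <= phi k by case/andP: (phi01 k).
  by rewrite !Poisson_expectation// poisson_mean_dominated// !ltW.
split => //.
- by apply: le_ereal_inf_tmp => _ [x [xy gxy] <-]; exact: up.
- by apply: le_ereal_inf_tmp => _ [x [xy gxy] <-]; exact: down.
- apply: le_ereal_inf_tmp => _ [x xy <-]; rewrite -inv ge_min.
  case/orP: (leq_total (g x.1) (g x.2)) => gxy.
    by rewrite up.
  by rewrite down ?orbT.
Qed.
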